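(* For the problem of maximizing a non-negative symmetric submodular function $f:2^N\to\mathbb{R}$ (given by a value oracle, $n=|N|$) under a knapsack constraint $\{S\subseteq N:\sum_{j\in S}a_j\le b\}$ with $a\in[0,1]^n$ and $b\ge 1$, there is an algorithm that has an approximation ratio of $\frac{1}{2}(1-e^{-2})$ and uses $O(n^4)$ value-oracle queries.
   Context: $f$ is symmetric if $f(S)=f(N\setminus S)$ for all $S\subseteq N$; submodular if $f(S)+f(T)\ge f(S\cup T)+f(S\cap T)$ for all $S,T$. An approximation ratio $\alpha$ means the algorithm outputs a feasible set whose value is at least $\alpha$ times the maximum value of a feasible set. The query complexity is the number of evaluations of $f$. *)

(* Defs.v *)
From HB Require Import structures.
From mathcomp Require Import all_boot all_order all_algebra.
From mathcomp Require Import reals.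

Set Implicit Arguments.
Unset Strict Implicit.
Unset Printing Implicit Defensive.

Import Order.TTheory GRing.Theory Num.Theory.
Local Open Scope ring_scope.

Section SetFunctions.
Variables (R : realType) (N : finType).
Implicit Types (f : {set N} -> R) (a : N -> R) (b : R) (S T : {set N}).

Definition nonneg f := forall S, 0 <= f S.

Definition symmetric_fun f := forall S, f S = f (~: S).

Definition submodular f :=
  forall S T, f (S :|: T) + f (S :&: T) <= f S + f T.

Definition feasible a b S := \sum_(j in S) a j <= b.

Definition knapsack_instance f a b :=
  [/\ nonneg f, symmetric_fun f, submodular f,
      (forall j, 0 <= a j <= 1) & 1 <= b].

Definition approx_solution (alpha : R) f a b S :=
  feasible a b S /\ forall T, feasible a b T -> alpha * f T <= f S.

End SetFunctions.

(* Deterministic adaptive computation in the value-oracle model: either output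
   a set, or ask for the value of the objective at a set and continue according
   to the answer.  The objective is accessible only through [Query]; being an
   inductive type, every computation halts on every oracle. *)
Inductive oracle_comp (R : realType) (N : finType) : Type :=
| Output of {set N}
| Query of {set N} & (R -> oracle_comp R N).

Arguments Output {R N} _.
Arguments Query {R N} _ _.

Fixpoint output (R : realType) (N : finType) (f : {set N} -> R)
    (c : oracle_comp R N) : {set N} :=
  match c with
  | Output U => U
  | Query U k => output f (k (f U))
  end.

(* Repeated queries to the same set are counted each time. *)
Fixpoint queries (R : realType) (N : finType) (f : {set N} -> R)
    (c : oracle_comp R N) : nat :=
  match c with
  | Output _ => 0%N
  | Query U k => (queries f (k (f U))).+1
  end.

(* The ground set and the knapsack data (a, b) are explicit input, whereas f is
   given only through the oracle. *)
Definition knapsack_algorithm (R : realType) :=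
  forall N : finType, (N -> R) -> R -> oracle_comp R N.

Definition has_approx_ratio (R : realType) (alpha : R)
    (A : knapsack_algorithm R) :=
  forall (N : finType) (f : {set N} -> R) (a : N -> R) (b : R),
    knapsack_instance f a b ->
    approx_solution alpha f a b (output f (A N a b)).

(* Worst-case number of queries is O(g(n)), n = #|N|; the constant is uniform
   over ground sets, objectives and knapsack data. *)
Definition query_complexity_O (R : realType) (g : nat -> nat)
    (A : knapsack_algorithm R) :=
  exists C n0 : nat,
  forall (N : finType) (f : {set N} -> R) (a : N -> R) (b : R),
    (n0 <= #|N|)%N -> knapsack_instance f a b ->
    (queries f (A N a b) <= C * g #|N|)%N.

(* Main.v *)
(* If [A] is deletion-optimal (no removal of an element improves it), symmetry and
   submodularity give [f O <= f (A :|: O) + f (A :\: O)] with [f (A :\: O) <= f A],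
   so the elements of [O] have total marginal at least [f O - 2 * f A] over [A].
   Adding elements at the best density would thus give the differential equation
   [h' = f O - 2 * h], whose solution at time 1 is [(1 - exp (- 2)) / 2 * f O]; the
   difficulty is that near the end the heavy elements of [O] no longer fit.

   This is avoided by dynamic programming over consumed capacity: [T y c] is a
   deletion-optimal set in which the "slot" element [y] is free of charge and the
   rest costs at most [c] units.  Moves add an element, or replace [y] by another
   slot element [z], after which the set belongs to column [z].  Let [e1], [e2] be
   the two heaviest elements of [O] and let [y] be the better of the two columns at
   level [c].  As swapping does not help, the marginal of the other one is at most
   that of [y] over [A :\ y], while [f (A :\: O) <= f (A :\ y)]; the two corrections
   cancel, so the rate [f O - 2 * h] is available from [O :\ e1 :\ e2] alone.  All of
   its elements fit up to level [b - a e1 - a e2], which is at least its cost, so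
   that nothing is lost at the end.

   Costs have to be rounded up to units.  With [b / (1024 n^2)] as unit this loses a
   fraction [O(1 / n)], which is made up for either by the head start
   [max (f [set e1]) (f [set e2])] or, if that is tiny, by dropping [e1] from [O].
   If [e1] and [e2] use more than half of [b], the remaining capacity may be too
   small for this unit; then, unless [e1] can be dropped, the head start is a
   constant fraction of [f O], and a table for the pair with [O(n)] levels is
   enough.  Both families of tables take [O(n^4)] queries. *)
Require Import Defs.
From mathcomp Require Import all_boot all_order all_algebra.
From mathcomp Require Import reals sequences exp.
From mathcomp Require Import ring lra zify.
Import Order.TTheory GRing.Theory Num.Theory.
Local Open Scope ring_scope.

Set Implicit Arguments.
Unset Strict Implicit.
Unset Printing Implicit Defensive.

(** * Symmetric submodular functions *)

Section SymmetricSubmodular.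
Variables (R : realType) (N : finType) (f : {set N} -> R).
Hypotheses (f0 : nonneg f) (fsym : symmetric_fun f) (fsub : submodular f).
Implicit Types (A B O X Z : {set N}) (u y e : N).

Lemma marginal_decreasing A B u : A \subset B -> u \notin B ->
  f (u |: B) - f B <= f (u |: A) - f A.
Proof.
move=> AB uB; have := fsub B (u |: A).
have -> : B :|: (u |: A) = u |: B.
  by rewrite setUC -setUA (setUidPr AB).
have -> : B :&: (u |: A) = A.
  rewrite setIUr (setIidPr AB); apply/setUidPr/subsetP => x.
  by rewrite !inE => /andP[xB /eqP xu]; rewrite -xu xB in uB.
lra.
Qed.

Lemma le_sum_marginals A X :
  f (A :|: X) - f A <= \sum_(u in X) (f (u |: A) - f A).
Proof.
elim: {X}#|X| {-2}X (erefl #|X|) => [|n IH] X.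
  by move/eqP; rewrite cards_eq0 => /eqP ->; rewrite setU0 subrr big_set0.
move=> cX; have /card_gt0P[u uX] : (0 < #|X|)%N by rewrite cX.
have cX' : #|X :\ u| = n by move: cX; rewrite (cardsD1 u) uX => -[].
have := IH _ cX'; rewrite (big_setD1 u uX) /=.
have -> : A :|: X = u |: (A :|: X :\ u) by rewrite setUCA setD1K.
have [uA|uA] := boolP (u \in A).
  have -> : u |: A = A by apply/setUidPr; rewrite sub1set.
  have -> : u |: (A :|: X :\ u) = A :|: X :\ u.
    by apply/setUidPr; rewrite sub1set inE uA.
  by rewrite subrr add0r.
have uAX : u \notin A :|: X :\ u by rewrite !inE negb_or uA eqxx.
have := marginal_decreasing (subsetUl A (X :\ u)) uAX.
lra.
Qed.

(** Submodularity for [A :|: O] and the complement of [A :\: O], which meet in [O]; symmetry then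
    removes the complement. *)
Lemma posimodular A O : f O <= f (A :|: O) + f (A :\: O).
Proof.
have := fsub (A :|: O) (~: (A :\: O)); rewrite -fsym.
have -> : (A :|: O) :&: ~: (A :\: O) = O.
  by apply/setP => x; rewrite !inE; case: (x \in O); case: (x \in A).
by have := f0 ((A :|: O) :|: ~: (A :\: O)); lra.
Qed.

(** Submodularity for [A] and its complement. It makes singletons deletion-optimal, so that they can
    start a table. *)
Lemma set0_min A : f set0 <= f A.
Proof.
have := fsub A (~: A); rewrite setUCr setICr -(fsym A).
have -> : f [set: N] = f set0 by rewrite fsym setCT.
lra.
Qed.

Lemma le_setD1 O e : f O <= f [set e] + f (O :\ e).
Proof.
have [eO|eO] := boolP (e \in O); last first.
  have -> : O :\ e = O by apply/setDidPl; rewrite disjoint_sym disjoints1.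
  by have := f0 [set e]; lra.
have := fsub [set e] (O :\ e); rewrite setD1K//.
by have := f0 ([set e] :&: (O :\ e)); lra.
Qed.

Definition deletion_optimal A := forall e, e \in A -> f (A :\ e) <= f A.

Lemma deletion_optimal_marginal A B e :
  B \subset A -> e \in B -> f (A :\ e) <= f A -> f (B :\ e) <= f B.
Proof.
move=> BA eB fA; have eA := subsetP BA e eB.
have := @marginal_decreasing (B :\ e) (A :\ e) e (setSD _ BA).
by rewrite !inE eqxx !setD1K// => /(_ isT); lra.
Qed.

Lemma deletion_optimal_setD1 A e : deletion_optimal A -> deletion_optimal (A :\ e).
Proof.
move=> dA v vA; apply: (deletion_optimal_marginal (subD1set A e) vA).
by apply: dA; case/setD1P: vA.
Qed.

(** Single deletions suffice: putting the elements of [A :\: Z] back one by one never loses, since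
    each marginal is at least the one over the rest of [A]. *)
Lemma deletion_optimal_le A Z : deletion_optimal A -> Z \subset A -> f Z <= f A.
Proof.
move=> dA; elim: {Z}#|A :\: Z| {-2}Z (erefl #|A :\: Z|) => [|n IH] Z.
  move/eqP; rewrite cards_eq0 setD_eq0 => AZ ZA.
  by have -> : Z = A by apply/eqP; rewrite eqEsubset ZA.
move=> cZ ZA; have /card_gt0P[e] : (0 < #|A :\: Z|)%N by rewrite cZ.
rewrite inE => /andP[eZ eA].
have eZA : e |: Z \subset A by rewrite subUset sub1set eA.
apply: le_trans (IH (e |: Z) _ eZA).
  by have := deletion_optimal_marginal eZA (setU11 e Z) (dA e eA); rewrite setU1K.
move: cZ; rewrite (cardsD1 e) inE eZ eA => -[<-].
by apply: eq_card => x; rewrite !inE negb_or andbA.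
Qed.

(* [k] is the best value after the next swap of the slot element: if [y] is
   still used, whatever [e] adds to [A] it adds to [A :\ y], so its marginal is
   paid for by that of [y], which [A :\: O] lacks. *)
Lemma slot_bound A O y e k : deletion_optimal A -> y \in O -> e \in O -> y != e ->
  f (e |: A :\ y) <= k -> f (y |: A :\ y) <= k -> f A <= k ->
  f O <= 2 * k + \sum_(u in O :\ y :\ e) (f (u |: A) - f A).
Proof.
move=> dA yO eO ye ek yk Ak.
have := posimodular A O; have := le_sum_marginals A O.
rewrite (big_setD1 y yO) /= (big_setD1 e) /=; last by rewrite !inE eq_sym ye.
set S := \sum_(_ in _) _.
have [yA|yA] := boolP (y \in A).
  have -> : y |: A = A by apply/setUidPr; rewrite sub1set.
  have AO : f (A :\: O) <= f (A :\ y).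
    apply: deletion_optimal_le; first exact: deletion_optimal_setD1.
    by apply: setDS; rewrite sub1set.
  have [eA|eA] := boolP (e \in A).
    have -> : e |: A = A by apply/setUidPr; rewrite sub1set.
    have := dA y yA; lra.
  have := marginal_decreasing (subD1set A y) eA; lra.
(* Without [y] in [A], adding [y] or [e] to [A] is already one of the two moves bounded by [k]. *)
have AO : f (A :\: O) <= f A by apply: deletion_optimal_le => //; exact: subsetDl.
move: ek yk; have -> : A :\ y = A by apply/setDidPl; rewrite disjoint_sym disjoints1.
lra.
Qed.

End SymmetricSubmodular.

(* One of the moves [1, w u] improves [K] at a rate at least that of the ODE
   [K' = (V - 2 K) / L]. *)
Lemma decay (R : realType) (N : finType) (I : {set N}) (w : N -> nat)
    (K : nat -> R) (V : R) (p F : nat) :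
  (forall u, 0 < w u)%N ->
  (forall c d, (c <= d <= F)%N -> K c <= K d) ->
  (p <= F)%N -> (forall u c, u \in I -> (c < p)%N -> (c + w u <= F)%N) ->
  (forall c, (c < p)%N ->
    V <= 2 * K c.+1 + \sum_(u in I) (K (c + w u)%N - K c)) ->
  V - 2 * K F <= Num.max 0 (V - 2 * K 0%N) *
    expR (- 2 * p%:R / ((\sum_(u in I) w u)%N%:R + 2)).
Proof.
move=> w0 Kmono pF wF step.
set L := _ + 2; set D : R := Num.max _ _.
have L0 : 0 < L by rewrite /L ltr_wpDl// ler0n.
(* [E] solves the differential equation for the gap; a sufficiently good move stays below it because
   [1 + x <= expR x]. *)
pose E (c : R) : R := D * expR (- 2 * c / L).
have D0 : 0 <= D by rewrite le_max lexx.
have E0 c : 0 <= E c by rewrite mulr_ge0// ltW// expR_gt0.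
have Emono (c d : R) : d <= c -> E c <= E d.
  move=> cd; rewrite ler_wpM2l// ler_expR ler_pM2r ?invr_gt0//; lra.
have Estep c s : V - 2 * K c <= E c%:R -> 0 <= V - 2 * K c ->
    s%:R / L * (V - 2 * K c) <= K (c + s)%N - K c ->
    V - 2 * K (c + s)%N <= E (c + s)%:R.
  move=> Ec Kc Ks.
  have -> : E (c + s)%:R = E c%:R * expR (- 2 * s%:R / L).
    by rewrite /E natrD mulrDr mulrDl expRD mulrA.
  apply: (@le_trans _ _ ((V - 2 * K c) * expR (- 2 * s%:R / L))); last first.
    by rewrite ler_wpM2r// ltW// expR_gt0.
  apply: (@le_trans _ _ ((V - 2 * K c) * (1 + - 2 * s%:R / L))); last first.
    by rewrite ler_wpM2l// expR_ge1Dx.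
  have -> : - 2 * s%:R / L = - 2 * (s%:R / L) by rewrite mulrA.
  lra.
have E00 : V - 2 * K 0%N <= E 0%:R.
  by rewrite /E mulr0 mul0r expR0 mulr1 /D le_max lexx orbT.
rewrite -/(E p%:R); clearbody E.
suff main j c : (p - c <= j)%N -> (c <= F)%N -> V - 2 * K c <= E c%:R ->
    V - 2 * K F <= E p%:R.
  by apply: (main p 0%N); rewrite ?subn0.
elim: j c => [|j IH] c pcj cF Ec.
  have KcF := Kmono c F; rewrite cF leqnn in KcF.
  apply: (@le_trans _ _ (E c%:R)); last by apply: Emono; rewrite ler_nat; lia.
  by apply: le_trans Ec; have := KcF isT; lra.
have [pc|cp] := leqP p c; first by apply: (IH c) => //; lia.
have [Kc|Kc] := leP 0 (V - 2 * K c); last first.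
  have := Kmono c F; rewrite cF leqnn => /(_ isT).
  by move=> KF; apply: le_trans (E0 p%:R); lra.
have [K1|K1] := leP (1%:R / L * (V - 2 * K c)) (K (c + 1)%N - K c).
  apply: (IH (c + 1)%N); [lia|lia|exact: Estep].
have [u /andP[uI uK]|noK] := pickP (fun u => (u \in I) &&
    ((w u)%:R / L * (V - 2 * K c) <= K (c + w u)%N - K c)).
  have := wF u c uI cp; have := w0 u => wu cw.
  apply: (IH (c + w u)%N); [lia|exact: cw|exact: Estep].
(* If all moves were too slow, their gains would sum to less than the gap [V - 2 * K c]. The 2 in
   [L] accounts for the coefficient of [K c.+1]. *)
exfalso; have := step c cp; apply/negP; rewrite -ltNge.
have : \sum_(u in I) (K (c + w u)%N - K c) <=
    \sum_(u in I) (w u)%:R / L * (V - 2 * K c).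
  apply: ler_sum => u uI; have := noK u; rewrite uI /= => /negbT.
  by rewrite -ltNge => /ltW.
rewrite -!mulr_suml -natr_sum addn1 in K1 *.
move=> S; rewrite -addn1.
have LL : (\sum_(u in I) w u)%N%:R / L = 1 - 2 / L.
  by rewrite /L; field; exact: lt0r_neq0.
move: S K1; rewrite LL !addn1 mulrBl !mul1r.
set x := L^-1 * _ => S K1.
have x2 : 2 / L * (V - 2 * K c) = 2 * x by rewrite /x mulrA.
move: S; rewrite x2; lra.
Qed.

(** * Oracle programs and the table *)

Section Programs.
Variables (R : realType) (N : finType).

(** Oracle computations with results of any type, so that they compose by [bind]. *)
Inductive prog (X : Type) : Type :=
| Ret of X
| Ask of {set N} & (R -> prog X).

Arguments Ret {X} _.
Arguments Ask {X} _ _.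

Fixpoint bind X Y (p : prog X) (k : X -> prog Y) : prog Y :=
  match p with
  | Ret x => k x
  | Ask U h => Ask U (fun r => bind (h r) k)
  end.

Fixpoint to_oracle (p : prog {set N}) : oracle_comp R N :=
  match p with
  | Ret U => Output U
  | Ask U h => Query U (fun r => to_oracle (h r))
  end.

(** A Hoare-style postcondition together with a query budget, for a fixed oracle. *)
Fixpoint ensures (f : {set N} -> R) X (p : prog X) (Q : X -> Prop) (q : nat) : Prop :=
  match p with
  | Ret x => Q x
  | Ask U h => if q is q'.+1 then ensures f (h (f U)) Q q' else False
  end.

Lemma ensures_weaken f X (p : prog X) (Q Q' : X -> Prop) q q' :
  (forall x, Q x -> Q' x) -> (q <= q')%N -> ensures f p Q q -> ensures f p Q' q'.
Proof.
move=> QQ; elim: p q q' => [x|U h IH] q q' qq /=; first exact: QQ.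
by case: q qq => [//|q]; case: q' => [//|q'] qq; exact: IH.
Qed.

Lemma ensures_bind f X Y (p : prog X) (k : X -> prog Y) Q Q' q q' :
  ensures f p Q q -> (forall x, Q x -> ensures f (k x) Q' q') ->
  ensures f (bind p k) Q' (q + q').
Proof.
move=> pQ kQ; elim: p q pQ => [x|U h IH] q /=.
  by move=> /kQ; apply: ensures_weaken => //; exact: leq_addl.
by case: q => [//|q]; exact: IH.
Qed.

Lemma ensures_to_oracle f (p : prog {set N}) Q q : ensures f p Q q ->
  Q (output f (to_oracle p)) /\ (queries f (to_oracle p) <= q)%N.
Proof.
elim: p q => [U|U h IH] q //=; case: q => [//|q] /IH[? ?]; by split.
Qed.

Fixpoint argmaxq (B : {set N}) (l : seq {set N}) : prog {set N} :=
  if l is U :: l' then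
    Ask B (fun rB => Ask U (fun rU => argmaxq (if rB < rU then U else B) l'))
  else Ret B.

Lemma argmaxqP f B l :
  ensures f (argmaxq B l)
    (fun C => C \in B :: l /\ forall A : {set N}, A \in B :: l -> f A <= f C)
    (2 * size l).
Proof.
elim: l B => [|U l IH] B.
  by split=> [|A]; rewrite inE ?eqxx// => /eqP ->.
rewrite (_ : 2 * size (U :: l) = (2 * size l).+2)%N /=; last by rewrite mulnS.
move: (IH (if f B < f U then U else B)).
apply: ensures_weaken => // C [Cl Cmax]; split.
  move: Cl; rewrite !inE => /orP[/eqP ->|->]; last by rewrite !orbT.
  by case: ifP; rewrite eqxx ?orbT.
have UB : f U <= f C /\ f B <= f C.
  have := Cmax _ (mem_head _ _); case: ltP => [BU UC|UB BC]; split=> //.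
    exact: le_trans (ltW BU) UC.
  exact: le_trans UB BC.
move=> A; rewrite !inE => /or3P[/eqP->|/eqP->|Al]; [exact: UB.2|exact: UB.1|].
by apply: Cmax; rewrite inE Al orbT.
Qed.

Fixpoint prune (l : seq N) (A : {set N}) : prog {set N} :=
  if l is e :: l' then
    Ask A (fun r => Ask (A :\ e) (fun r' => prune l' (if r < r' then A :\ e else A)))
  else Ret A.

(* One pass is enough: removals only increase the marginals of what remains. *)
Lemma pruneP f l A : submodular f ->
  ensures f (prune l A)
    (fun B => [/\ B \subset A, f A <= f B &
               forall e, e \in l -> e \in B -> f (B :\ e) <= f B])
    (2 * size l).
Proof.
move=> fsub; elim: l A => [|e l IH] A; first by split.
rewrite (_ : 2 * size (e :: l) = (2 * size l).+2)%N /=; last by rewrite mulnS.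
move: (IH (if f A < f (A :\ e) then A :\ e else A)).
apply: ensures_weaken => // B; case: ltP => [lt [BA AB Bl]|le [BA AB Bl]]; split.
- exact: subset_trans BA (subD1set _ _).
- exact: le_trans (ltW lt) AB.
- move=> v; rewrite inE => /orP[/eqP ->|vl] vB; last exact: Bl.
  by have := subsetP BA e vB; rewrite !inE eqxx.
- exact: BA.
- exact: AB.
- move=> v; rewrite inE => /orP[/eqP ->|vl] vB; last exact: Bl.
  exact: deletion_optimal_marginal BA vB le.
Qed.

(** * Dynamic programming tables *)

Section Tables.
Variables (f : {set N} -> R) (fsub : submodular f) (w : N -> nat).
Variables (slots : seq N).
Hypothesis w0 : forall u, (0 < w u)%N.

Definition entry (t : seq (N -> {set N})) c y := nth (fun=> set0) t c y.

Definition weight (A : {set N}) := \sum_(u in A) w u.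

Lemma weightS (A B : {set N}) : A \subset B -> (weight A <= weight B)%N.
Proof. by move=> AB; rewrite /weight [leqRHS](big_setID A) (setIidPr AB) leq_addr. Qed.

Lemma weightU1 u A : (weight (u |: A) <= w u + weight A)%N.
Proof.
have [uA|uA] := boolP (u \in A).
  by rewrite (setUidPr _) ?sub1set// leq_addl.
by rewrite /weight big_setU1.
Qed.

(* Row [c], column [y]: the slot element [y] is free of charge, the other
   elements have total weight at most [c]. *)
Record table_ok (t : seq (N -> {set N})) : Prop := TableOk {
  table_gt0 : (0 < size t)%N;
  table_start : forall y, entry t 0 y = [set y];
  table_weight : forall c y, (c < size t)%N -> y \in slots ->
    (weight (entry t c y :\ y) <= c)%N;
  table_deletion : forall c y, (c < size t)%N -> y \in slots ->
    deletion_optimal f (entry t c y);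
  table_mono : forall c y, (c.+1 < size t)%N -> y \in slots ->
    f (entry t c y) <= f (entry t c.+1 y);
  table_add : forall c u y, (c + w u < size t)%N -> y \in slots ->
    f (u |: entry t c y) <= f (entry t (c + w u) y);
  table_swap : forall c y z, (c.+1 < size t)%N -> y \in slots -> z \in slots ->
    f (z |: entry t c y :\ y) <= f (entry t c.+1 z)
}.

(** These are for the next row, of index [size t]. The filter excludes elements for which the
    subtraction would truncate; [z = y] among the swaps restores a pruned slot element. *)
Definition candidates t y : seq {set N} :=
  [seq u |: entry t (size t - w u) y | u <- enum N & (w u <= size t)%N] ++
  [seq y |: entry t (size t).-1 z :\ z | z <- slots].

Definition improve t y : prog {set N} :=
  bind (argmaxq (entry t (size t).-1 y) (candidates t y)) (prune (enum N)).

Definition improves t y (B : {set N}) :=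
  [/\ (weight (B :\ y) <= size t)%N, deletion_optimal f B &
      forall A, A \in entry t (size t).-1 y :: candidates t y -> f A <= f B].

Lemma improveP t y : table_ok t -> y \in slots ->
  ensures f (improve t y) (improves t y) (4 * #|N| + 2 * size slots).
Proof.
move=> tok ys; have t0 := table_gt0 tok.
have tp z : z \in slots -> (weight (entry t (size t).-1 z :\ z) <= (size t).-1)%N.
  by apply: (table_weight tok); rewrite prednK.
apply: (@ensures_weaken _ _ _ (improves t y) _
    (2 * size (candidates t y) + 2 * size (enum N))) => //.
  have sN : size (enum N) = #|N| by rewrite -cardE.
  have : (size [seq u <- enum N | (w u <= size t)%N] <= #|N|)%N.
    by rewrite -sN size_filter count_size.
  by rewrite sN /candidates size_cat !size_map; lia.
apply: ensures_bind (argmaxqP _ _ _) _ => B [Bin Bmax].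
apply: ensures_weaken (leqnn _) (pruneP (enum N) B fsub) => C [CB BC Cdel].
split; last 1 first.
- by move=> A /Bmax; move/le_trans; apply.
- apply: (leq_trans (weightS (setSD [set y] CB))).
  move: Bin; rewrite inE mem_cat => /or3P[/eqP ->|/mapP[u]|/mapP[z]].
  + by apply: (leq_trans (tp y ys)); exact: leq_pred.
  + rewrite mem_filter => /andP[ut _] ->.
    have le : (weight (entry t (size t - w u) y :\ y) <= size t - w u)%N.
      apply: (table_weight tok) => //; have := w0 u; lia.
    apply: (@leq_trans (weight (u |: entry t (size t - w u) y :\ y))).
      by apply: weightS; rewrite setDUl setSU// subD1set.
    by apply: (leq_trans (weightU1 _ _)); lia.
  (* The slot passes from [z] to [y]: [z] is gone and [y] becomes free, so the charged part does not
     grow. *)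
  + move=> zs ->; apply: (@leq_trans (weight (entry t (size t).-1 z :\ z))).
      apply: weightS; apply/subsetP => x; rewrite !inE.
      by case/andP => /negbTE ->.
    by apply: (leq_trans (tp z zs)); exact: leq_pred.
- by move=> e eC; apply: Cdel => //; rewrite mem_enum.
Qed.

Fixpoint level t (ys : seq N) : prog (N -> {set N}) :=
  if ys is y :: ys' then
    bind (improve t y) (fun B => bind (level t ys') (fun g =>
      Ret (fun z => if z == y then B else g z)))
  else Ret (fun=> set0).

Lemma levelP t ys : table_ok t -> {subset ys <= slots} ->
  ensures f (level t ys) (fun g => forall y, y \in ys -> improves t y (g y))
    (size ys * (4 * #|N| + 2 * size slots)).
Proof.
move=> tok; elim: ys => [|y ys IH] yss //=; rewrite mulSn.
apply: ensures_bind (improveP tok _) _ => [|B Bimp].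
  by apply: yss; exact: mem_head.
rewrite -[X in ensures _ _ _ X]addn0.
apply: ensures_bind (IH _) _ => [z zys|g gimp /= z].
  by apply: yss; rewrite inE zys orbT.
rewrite inE; have [->//|_ /=] := eqVneq z y; exact: gimp.
Qed.

Lemma table_ok_rcons t g : table_ok t ->
  (forall y, y \in slots -> improves t y (g y)) -> table_ok (rcons t g).
Proof.
move=> tok gimp; have t0 := table_gt0 tok.
have old c y : (c < size t)%N -> entry (rcons t g) c y = entry t c y.
  by move=> ct; rewrite /entry nth_rcons ct.
have new y : entry (rcons t g) (size t) y = g y.
  by rewrite /entry nth_rcons ltnn eqxx.
split; rewrite ?size_rcons//.
- by move=> y; rewrite old// (table_start tok).
- move=> c y; rewrite ltnS leq_eqVlt => /orP[/eqP -> ys|ct ys].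
    by rewrite new; case: (gimp _ ys).
  by rewrite old//; exact: (table_weight tok).
- move=> c y; rewrite ltnS leq_eqVlt => /orP[/eqP -> ys|ct ys].
    by rewrite new; case: (gimp _ ys).
  by rewrite old//; exact: (table_deletion tok).
- move=> c y; rewrite ltnS leq_eqVlt => /orP[/eqP ct ys|ct ys].
    rewrite ct new old -?ct//; case: (gimp _ ys) => _ _; apply.
    by rewrite -ct /= mem_head.
  by rewrite !old ?(ltnW ct)//; exact: (table_mono tok).
- move=> c u y; rewrite ltnS leq_eqVlt => /orP[/eqP ct ys|ct ys].
    rewrite ct new old; last by have := w0 u; lia.
    case: (gimp _ ys) => _ _; apply; rewrite inE mem_cat; apply/or3P/Or32.
    apply/mapP; exists u; last by rewrite -ct addnK.
    by rewrite mem_filter mem_enum -ct leq_addl.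
  rewrite !old ?(leq_ltn_trans (leq_addr _ _) ct)//; exact: (table_add tok).
- move=> c y z; rewrite ltnS leq_eqVlt => /orP[/eqP ct ys zs|ct ys zs].
    rewrite ct new old -?ct//; case: (gimp _ zs) => _ _; apply.
    rewrite inE mem_cat; apply/or3P/Or33/mapP; exists y => //.
    by rewrite -ct.
  by rewrite !old ?(ltnW ct)//; exact: (table_swap tok).
Qed.

Fixpoint grow (m : nat) : prog (seq (N -> {set N})) :=
  if m is m'.+1 then
    bind (grow m') (fun t => bind (level t slots) (fun g => Ret (rcons t g)))
  else Ret [:: fun y => [set y]].

Lemma growP m : nonneg f -> symmetric_fun f ->
  ensures f (grow m) (fun t => table_ok t /\ size t = m.+1)
    (m * (size slots * (4 * #|N| + 2 * size slots))).
Proof.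
move=> f0 fsym; elim: m => [|m IH] /=.
  split=> //; split=> //=.
  - move=> [|//] y _ _; rewrite /entry /= /weight big1// => u.
    by rewrite !inE => /andP[/negbTE ->].
  - move=> [|//] y _ _ e; rewrite /entry /= inE => /eqP ->.
    by rewrite setDv; exact: set0_min.
  - by move=> c u y; have := w0 u; lia.
rewrite mulSnr; apply: ensures_bind IH _ => t [tok tm].
rewrite -[X in ensures _ _ _ X]addn0.
apply: ensures_bind (levelP tok _) _ => //= g gimp.
by split; [exact: table_ok_rcons|rewrite size_rcons tm].
Qed.

End Tables.

End Programs.

(** * Value reached by a table *)

Section Guarantee.
Variables (R : realType) (N : finType) (f : {set N} -> R).
Hypotheses (f0 : nonneg f) (fsym : symmetric_fun f) (fsub : submodular f).
Variables (a : N -> R) (b : R).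
Hypothesis a0 : forall v, 0 <= a v.

(* The value is [m.+1], larger than any capacity in use, if [a v > m * unit]. *)
Definition units (unit : R) (m : nat) (v : N) : nat :=
  (find (fun k => a v <= k.+1%:R * unit) (iota 0 m)).+1.

Lemma le_units unit m v : (units unit m v <= m)%N -> a v <= (units unit m v)%:R * unit.
Proof.
rewrite /units => wm; set P := fun k : nat => _ in wm *.
have hasP : has P (iota 0 m) by rewrite has_find size_iota.
by have := nth_find 0%N hasP; rewrite /P nth_iota.
Qed.

Lemma units_le unit m v : ((units unit m v)%:R - 1) * unit <= a v.
Proof.
rewrite /units -natr1 addrK; set P := fun k : nat => _.
case E : (find P (iota 0 m)) => [|k]; first by rewrite mul0r.
have km : (k < find P (iota 0 m))%N by rewrite E.
have := before_find 0%N km; rewrite nth_iota; last first.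
  by apply: leq_trans km _; rewrite -{2}(size_iota 0 m) find_size.
by rewrite /P /= add0n => /negbT; rewrite -ltNge => /ltW.
Qed.

Section Table.
Variables (unit : R) (m : nat) (slots : seq N) (t : seq (N -> {set N})).
Let w := units unit m.
Hypotheses (unit0 : 0 <= unit) (tok : table_ok f w slots t) (tm : size t = m.+1).

Lemma entry_feasible c y : (c <= m)%N -> y \in slots ->
  c%:R * unit + a y <= b -> feasible a b (entry t c y).
Proof.
move=> cm ys; apply: le_trans; set A := entry t c y.
have wA : (weight w (A :\ y) <= c)%N by apply: (table_weight tok); rewrite ?tm.
have -> : \sum_(j in A) a j = \sum_(j in A :&: [set y]) a j + \sum_(j in A :\ y) a j.
  by rewrite (big_setID [set y]).
rewrite addrC lerD//; last first.
  have [yA|yA] := boolP (y \in A).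
    by rewrite (setIidPr _) ?sub1set// big_set1.
  by rewrite (disjoint_setI0 _) ?big_set0// disjoint_sym disjoints1.
apply: (@le_trans _ _ (\sum_(j in A :\ y) (w j)%:R * unit)).
  apply: ler_sum => j jA; apply: le_units; apply: leq_trans cm.
  by apply: leq_trans wA; rewrite /weight (big_setD1 j jA) leq_addr.
by rewrite -mulr_suml -natr_sum ler_wpM2r// ler_nat.
Qed.

(** Level [p] leaves room for both [y1] and [y2], but the slot needs only one of them. The room of
    the other lets a last move overshoot [p] by any remaining element, as none is heavier than
    [y2]. *)
Lemma table_guarantee (O : {set N}) y1 y2 p :
  y1 \in slots -> y2 \in slots -> y1 \in O -> y2 \in O -> y1 != y2 ->
  a y2 <= a y1 -> (forall v, v \in O :\ y1 :\ y2 -> a v <= a y2) ->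
  (p <= m)%N -> p%:R * unit + a y1 + a y2 <= b ->
  (forall v c, v \in O :\ y1 :\ y2 -> (c < p)%N -> (c + w v <= m)%N) ->
  exists c y, [/\ (c <= m)%N, y \in slots, feasible a b (entry t c y) &
    f O - 2 * f (entry t c y) <=
    Num.max 0 (f O - 2 * Num.max (f [set y1]) (f [set y2])) *
    expR (- 2 * p%:R / ((\sum_(v in O :\ y1 :\ y2) w v)%N%:R + 2))].
Proof.
move=> s1 s2 O1 O2 y12 a21 aO pm pb wm.
(* [F] will be the last level at which the heavier slot element fits. *)
pose P F := (F <= m)%N && (F%:R * unit + a y1 <= b).
have Pp : P p by rewrite /P pm /=; have := a0 y2; lra.
have exP : exists F, P F by exists p.
have ubP F : P F -> (F <= m)%N by case/andP.
case: (ex_maxnP exP ubP) => F /andP[Fm Fb] Fmax.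
pose K c := Num.max (f (entry t c y1)) (f (entry t c y2)).
have Kge c y : y \in [:: y1; y2] -> f (entry t c y) <= K c.
  by rewrite !inE => /orP[] /eqP ->; rewrite /K le_max lexx ?orbT.
have KS c : (c < m)%N -> K c <= K c.+1.
  move=> cm; rewrite /K ge_max !le_max.
  by rewrite !(table_mono tok) ?tm// orbT.
have Kmono c d : (c <= d <= F)%N -> K c <= K d.
  case/andP; elim: d => [|d IH]; first by rewrite leqn0 => /eqP ->.
  rewrite leq_eqVlt ltnS => /orP[/eqP ->//|cd] dF.
  by apply: le_trans (IH cd (ltnW dF)) (KS _ _); exact: leq_trans dF Fm.
(* Rounding [a v] up costs at most one unit, which [c < p] leaves free. *)
have Fw v c : v \in O :\ y1 :\ y2 -> (c < p)%N -> (c + w v <= F)%N.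
  move=> vO cp; apply: Fmax; rewrite /P wm//= natrD.
  have := units_le unit m v; rewrite -/w => wv; have := aO v vO.
  have : c.+1%:R * unit <= p%:R * unit by rewrite ler_wpM2r// ler_nat.
  by rewrite -natr1; lra.
have Kstep c : (c < p)%N -> f O <= 2 * K c.+1 +
    \sum_(v in O :\ y1 :\ y2) (K (c + w v)%N - K c).
  move=> cp; have cm : (c.+1 < size t)%N by rewrite tm ltnS (leq_trans cp pm).
  suff main y e : y \in [:: y1; y2] -> e \in [:: y1; y2] -> y != e ->
      y \in slots -> e \in slots -> O :\ y :\ e = O :\ y1 :\ y2 ->
      y \in O -> e \in O -> K c = f (entry t c y) ->
      f O <= 2 * K c.+1 + \sum_(v in O :\ y1 :\ y2) (K (c + w v)%N - K c).
    case: (leP (f (entry t c y1)) (f (entry t c y2))) => K12.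
      apply: (main y2 y1); rewrite ?inE ?eqxx ?orbT//; first by rewrite eq_sym.
        by rewrite !setDDl setUC.
      by rewrite /K (max_idPr K12).
    apply: (main y1 y2); rewrite ?inE ?eqxx ?orbT//.
    by rewrite /K (max_idPl (ltW K12)).
  move=> y12' e12 ye ys es OE yO eO Kc.
  have := @slot_bound _ _ f f0 fsym fsub (entry t c y) O y e (K c.+1).
  move=> /(_ (table_deletion tok (ltnW cm) ys) yO eO ye); rewrite OE.
  have k1 : f (e |: entry t c y :\ y) <= K c.+1.
    by apply: le_trans (Kge _ _ e12); exact: (table_swap tok).
  have k2 : f (y |: entry t c y :\ y) <= K c.+1.
    by apply: le_trans (Kge _ _ y12'); exact: (table_swap tok).
  move=> /(_ k1 k2); rewrite -Kc => /(_ (KS _ _)) H.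
  apply: le_trans (H _) _; first exact: leq_trans cp pm.
  rewrite lerD2l; apply: ler_sum => v vO; rewrite lerD2r.
  apply: le_trans (Kge _ _ y12'); apply: (table_add tok) => //.
  by rewrite tm ltnS wm.
have pF : (p <= F)%N by exact: Fmax.
have := decay (I := O :\ y1 :\ y2) (w := w) (fun _ => isT) Kmono pF Fw Kstep.
have -> : K 0%N = Num.max (f [set y1]) (f [set y2]) by rewrite /K !(table_start tok).
move=> bound.
case: (leP (f (entry t F y1)) (f (entry t F y2))) => K12.
  exists F, y2; split => //; first by apply: entry_feasible => //; lra.
  by move: bound; rewrite /K (max_idPr K12).
exists F, y1; split => //; first exact: entry_feasible.
by move: bound; rewrite /K (max_idPl (ltW K12)).
Qed.

End Table.
End Guarantee.

Lemma card_setD2 (N : finType) (O : {set N}) y1 y2 : y1 \in O -> y2 \in O :\ y1 ->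
  (#|O :\ y1 :\ y2| + 2 <= #|N|)%N.
Proof.
move=> h1 h2; have := cardsD1 y1 O; have := cardsD1 y2 (O :\ y1).
by rewrite h1 h2; have := max_card O; lia.
Qed.

(** * From the bound for a table to the approximation ratio *)

Section Ratio.
Variables (R : realType) (N : finType) (f : {set N} -> R).
Hypotheses (f0 : nonneg f) (fsym : symmetric_fun f) (fsub : submodular f).
Variables (a : N -> R) (b : R).
Hypotheses (a01 : forall v, 0 <= a v <= 1) (b1 : 1 <= b).
Let a0 v : 0 <= a v. Proof. by case/andP: (a01 v). Qed.

Lemma units_min unit m v k : (k < m)%N -> a v <= k.+1%:R * unit ->
  (units a unit m v <= k.+1)%N.
Proof.
move=> km ak; rewrite /units ltnS leqNgt; apply/negP => kf.
by have := before_find 0%N kf; rewrite nth_iota// add0n ak.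
Qed.

Lemma expRN2_ge : 16^-1 <= expR (- 2 : R).
Proof.
have -> : (- 2 : R) = 4%:R * (- 2^-1) by field.
rewrite expRM_natl.
have h : (2^-1 : R) <= expR (- 2^-1) by have := expR_ge1Dx (- 2^-1 : R); lra.
have -> : 16^-1 = (2^-1 : R) ^+ 4 by field.
by rewrite lerXn2r// nnegrE ?invr_ge0// expR_ge0.
Qed.

(** The right-hand side is the chord on [0, 1] of the convex function [1 / (1 + 3 / 2 * t)], which
    dominates the exponential. *)
Lemma expRN_le (t : R) : 0 <= t <= 1 -> expR (- (3 / 2 * t)) <= 1 - 3 / 5 * t.
Proof.
move=> /andP[t0 t1]; rewrite expRN -[leRHS]invrK lef_pV2 ?posrE ?expR_gt0//; last first.
  by rewrite invr_gt0; lra.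
apply: le_trans (expR_ge1Dx _); rewrite -[leLHS]mul1r ler_pdivrMr; last lra.
nra.
Qed.

(* [K >= kap * V] makes up for the loss of a fraction [kap] of the time. *)
Lemma ratio_of_head_start (V K H kap rho : R) : 0 <= V -> kap * V <= K -> 0 <= kap ->
  1 - kap <= rho ->
  V - 2 * H <= Num.max 0 (V - 2 * K) * expR (- 2 * rho) ->
  2^-1 * (1 - expR (- 2)) * V <= H.
Proof.
move=> V0 VK kap0 kr VH.
suff : V - 2 * H <= V * expR (- 2) by lra.
apply: le_trans VH _.
apply: (@le_trans _ _ (V * expR (- 2 * kap) * expR (- 2 * rho))).
  rewrite ler_wpM2r ?expR_ge0// ge_max mulr_ge0 ?expR_ge0//=.
  apply: (@le_trans _ _ (V * (1 + - 2 * kap))); first lra.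
  by rewrite ler_wpM2l// expR_ge1Dx.
by rewrite -mulrA -expRD ler_wpM2l// ler_expR; lra.
Qed.

(* Dropping an element of value at most [t * V / 32] is worth it if it speeds up
   the rest by a factor [1 + 3 / 4 * t]. *)
Lemma ratio_of_speedup (V V1 K H t rho : R) : 0 <= V -> 0 <= t <= 1 ->
  (1 - t / 32) * V <= V1 -> 0 <= K -> 1 + 3 / 4 * t <= rho ->
  V1 - 2 * H <= Num.max 0 (V1 - 2 * K) * expR (- 2 * rho) ->
  2^-1 * (1 - expR (- 2)) * V <= H.
Proof.
move=> V0 /andP[t0 t1] VV1 K0 tr VH.
have V10 : 0 <= V1 by apply: le_trans VV1; rewrite mulr_ge0//; lra.
set om := expR (- 2); have om16 : 16^-1 <= om := expRN2_ge.
have E : expR (- 2 * rho) <= om * (1 - 3 / 5 * t).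
  apply: (@le_trans _ _ (om * expR (- (3 / 2 * t)))).
    by rewrite -expRD ler_expR; lra.
  by rewrite ler_wpM2l ?expR_ge0// expRN_le// t0.
have {}VH : V1 - 2 * H <= V1 * (om * (1 - 3 / 5 * t)).
  apply: le_trans VH _; apply: ler_pM => //; rewrite ?le_max ?lexx ?expR_ge0//.
  by rewrite ge_max V10 /=; lra.
have om1 : om <= 1 by rewrite -expR0 ler_expR; lra.
suff : (1 - om) * V <= V1 * (1 - om * (1 - 3 / 5 * t)) by lra.
apply: (@le_trans _ _ ((1 - t / 32) * V * (1 - om * (1 - 3 / 5 * t)))); last first.
  rewrite ler_wpM2r// subr_ge0 mulr_ile1//; lra.
rewrite mulrAC ler_wpM2r//.
(* Gain of the speedup minus loss of the dropped value; [om >= 1 / 16] makes it non-negative. *)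
suff : 0 <= t * (3 / 5 * om - (1 - om + 3 / 5 * om * t) / 32) by lra.
rewrite mulr_ge0//.
have : om * t <= om by rewrite ler_piMr//; lra.
lra.
Qed.

Lemma sum_units unit m (I : {set N}) :
  ((\sum_(v in I) units a unit m v)%N%:R - #|I|%:R) * unit <= \sum_(v in I) a v.
Proof.
rewrite natr_sum -sum1_card natr_sum -sumrB mulr_suml.
by apply: ler_sum => v _; exact: (units_le a0).
Qed.

Section TopTwo.
Variables (O : {set N}) (y1 y2 : N).
Hypotheses (O1 : y1 \in O) (O2 : y2 \in O :\ y1) (a21 : a y2 <= a y1).
Hypothesis aO : forall v, v \in O :\ y1 :\ y2 -> a v <= a y2.
Hypothesis Ob : feasible a b O.
Let O2' : y2 \in O. Proof. by case/setD1P: O2. Qed.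
Let y12 : y1 != y2. Proof. by case/setD1P: O2; rewrite eq_sym. Qed.

Lemma sum_rest : \sum_(v in O) a v = a y1 + a y2 + \sum_(v in O :\ y1 :\ y2) a v.
Proof. by rewrite (big_setD1 y1)//= (big_setD1 y2)//= addrA. Qed.

(** The term [#|N| * unit] pays for one unit of rounding per remaining element and for the 2 in the
    exponent, as the pair itself is excluded; the last [unit] pays for rounding [p] down. *)
Lemma fine_guarantee (unit : R) m slots t (rho : R) :
  0 < unit -> m%:R * unit = b ->
  table_ok f (units a unit m) slots t -> size t = m.+1 ->
  y1 \in slots -> y2 \in slots ->
  0 <= rho ->
  rho * (\sum_(v in O :\ y1 :\ y2) a v + #|N|%:R * unit) <=
    b - a y1 - a y2 - unit ->
  exists c y, [/\ (c <= m)%N, y \in slots, feasible a b (entry t c y) &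
    f O - 2 * f (entry t c y) <=
    Num.max 0 (f O - 2 * Num.max (f [set y1]) (f [set y2])) * expR (- 2 * rho)].
Proof.
move=> unit0 mb tok tm s1 s2 rho0 rhoP.
set S := \sum_(_ in _) _ in rhoP.
have S0 : 0 <= S by apply: sumr_ge0.
have l0 : 0 <= b - a y1 - a y2 by move: Ob; rewrite /feasible sum_rest -/S; lra.
have /truncn_itv : 0 <= (b - a y1 - a y2) / unit by rewrite divr_ge0// ltW.
set p := Num.truncn _; case/andP; rewrite ler_pdivlMr// ltr_pdivrMr// => pl lp.
have pm : (p <= m)%N.
  rewrite -(ler_nat R) -(ler_pM2r unit0) mb; have := a0 y1; have := a0 y2; lra.
have pb : p%:R * unit + a y1 + a y2 <= b by lra.
have wm v c : v \in O :\ y1 :\ y2 -> (c < p)%N -> (c + units a unit m v <= m)%N.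
  move=> vO cp; rewrite -(ler_nat R) -(ler_pM2r unit0) mb natrD.
  have := units_le a0 unit m v; have := aO vO; have := a0 y1.
  have : c.+1%:R * unit <= p%:R * unit by rewrite ler_pM2r// ler_nat.
  by rewrite -natr1; lra.
have [c [y [cm ys Fy bound]]] :=
  table_guarantee f0 fsym fsub a0 (ltW unit0) tok tm s1 s2 O1 O2' y12 a21 aO pm pb wm.
exists c, y; split => //; apply: le_trans bound _.
rewrite ler_wpM2l ?le_max ?lexx// ler_expR -mulrA !mulNr lerN2 ler_pM2l//.
rewrite ler_pdivlMr ?ltr_wpDl ?ler0n// -(ler_pM2r unit0).
have := sum_units unit m (O :\ y1 :\ y2); rewrite -/S.
have := card_setD2 O1 O2; rewrite -(ler_nat R) natrD => cN sN.
have : #|O :\ y1 :\ y2|%:R * unit + 2 * unit <= #|N|%:R * unit.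
  by rewrite -mulrDl ler_pM2r.
set L := (\sum_(v in _) _)%N%:R in sN *; move=> cNu.
rewrite -mulrA.
have : rho * ((L + 2) * unit) <= rho * (S + #|N|%:R * unit).
  by rewrite ler_wpM2l//; lra.
move: lp; rewrite -natr1; lra.
Qed.

(** Here [p = m] without rounding. Each remaining element takes at most [m] units, so [2 * m] levels
    contain every move from below [m]. *)
Lemma coarse_guarantee m slots t (rho : R) :
  (0 < m)%N -> let unit := (b - a y1 - a y2) / m%:R in
  table_ok f (units a unit (2 * m)) slots t -> size t = (2 * m).+1 ->
  y1 \in slots -> y2 \in slots ->
  0 <= rho -> rho * (m%:R + #|N|%:R) <= m%:R ->
  exists c y, [/\ (c <= 2 * m)%N, y \in slots, feasible a b (entry t c y) &
    f O - 2 * f (entry t c y) <=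
    Num.max 0 (f O - 2 * Num.max (f [set y1]) (f [set y2])) * expR (- 2 * rho)].
Proof.
move=> m0 unit tok tm s1 s2 rho0 rhoP.
have mR : 0 < m%:R :> R by rewrite ltr0n.
set S := \sum_(v in O :\ y1 :\ y2) a v.
have Sl : S <= b - a y1 - a y2 by move: Ob; rewrite /feasible sum_rest -/S; lra.
have S0 : 0 <= S by apply: sumr_ge0.
have mu : m%:R * unit = b - a y1 - a y2 by rewrite /unit; field; exact: lt0r_neq0.
have unit0 : 0 <= unit by rewrite divr_ge0//; lra.
clearbody unit; have pb : m%:R * unit + a y1 + a y2 <= b by lra.
have av v : v \in O :\ y1 :\ y2 -> a v <= m%:R * unit.
  move=> vO; apply: le_trans (le_trans Sl _); last by rewrite mu.
  by rewrite /S (big_setD1 v vO) /= lerDl sumr_ge0.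
have wle v k : v \in O :\ y1 :\ y2 -> (0 < k <= m)%N -> a v <= k%:R * unit ->
    (units a unit (2 * m) v <= k)%N.
  move=> vO /andP[k0 km] ak; rewrite -(prednK k0) in ak km *.
  by apply: (units_min _ ak); apply: leq_trans km _; rewrite leq_pmull.
have wm v c : v \in O :\ y1 :\ y2 -> (c < m)%N ->
    (c + units a unit (2 * m) v <= 2 * m)%N.
  move=> vO cm; have mm : (0 < m <= m)%N by rewrite m0 leqnn.
  rewrite [leqRHS]mul2n -addnn; apply: leq_add; [exact: ltnW|exact: (wle v m vO mm (av v vO))].
have pm : (m <= 2 * m)%N by rewrite leq_pmull.
have [c [y [cm ys Fy bound]]] :=
  table_guarantee f0 fsym fsub a0 unit0 tok tm s1 s2 O1 O2' y12 a21 aO pm pb wm.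
exists c, y; split => //; apply: le_trans bound _.
rewrite ler_wpM2l ?le_max ?lexx// ler_expR -mulrA !mulNr lerN2 ler_pM2l//.
rewrite ler_pdivlMr ?ltr_wpDl ?ler0n//; apply: le_trans rhoP; rewrite ler_wpM2l//.
have := card_setD2 O1 O2; rewrite -(ler_nat R) natrD => cN.
suff : (\sum_(v in O :\ y1 :\ y2) units a unit (2 * m) v)%N%:R - #|O :\ y1 :\ y2|%:R
    <= m%:R :> R by lra.
(* If the pair exhausts [b], all other elements of [O] cost 0 and have weight 1. *)
have [u0|u0] := eqVneq unit 0.
  rewrite lerBlDr -natrD ler_nat -sum1_card (leq_trans _ (leq_addl _ _))//.
  apply: leq_sum => v vO; apply: wle => //.
  by have := av v vO; rewrite u0 !mulr0.
have up : 0 < unit by rewrite lt_neqAle eq_sym u0.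
rewrite -(ler_pM2r up); apply: le_trans (sum_units _ _ _) _.
by rewrite mu.
Qed.

End TopTwo.
End Ratio.

(** With [d = b * x / 1024], the rounding losses are at most [3 / 2 * d], while the factor
    [1 - x / 256] saves at least [2 * d] because [l >= b / 2]. *)
Lemma rest_le_fine (R : realFieldType) (b x l S unit : R) : 0 < x -> x <= 2^-1 ->
  0 < b -> b / 2 <= l -> S <= l -> 2 * unit <= b * x / 1024 ->
  (1 - x / 256) * (S + b * x / 1024) <= l - unit.
Proof.
move=> x0 x2 b0 bl Sl ux.
have bx0 : 0 < b * x by exact: mulr_gt0.
have h1 : x * (b / 2) <= x * (l + b * x / 1024) by rewrite ler_pM2l//; lra.
have h2 : (1 - x / 256) * (S + b * x / 1024) <= (1 - x / 256) * (l + b * x / 1024).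
  by rewrite ler_wpM2l//; lra.
lra.
Qed.

(** Dropping an element frees [a1 = s * b]. The speedup uses at most [3 / 4 * a1] of it, and the
    rest exceeds the rounding losses. *)
Lemma rest_le_speedup (R : realFieldType) (b x s a1 l S unit : R) : 0 <= s -> 0 < b ->
  a1 = s * b -> x <= 8 * s -> l <= b -> S <= l - a1 -> 2 * unit <= b * x / 1024 ->
  (1 + 3 / 4 * s) * (S + b * x / 1024) <= l - unit.
Proof.
move=> s0 b0 a1E xs lb Sl ux.
have h0 : b * x <= 8 * a1 by have := xs; rewrite -(ler_pM2l b0) a1E; lra.
have h1 : (1 + 3 / 4 * s) * (S + b * x / 1024) <= (1 + 3 / 4 * s) * (l - 127 / 128 * a1).
  by rewrite ler_wpM2l//; lra.
have a10 : 0 <= a1 by rewrite a1E mulr_ge0// ltW.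
have h2 : s * (l - 127 / 128 * a1) <= s * b by rewrite ler_wpM2l//; lra.
rewrite -a1E in h2; lra.
Qed.

Section Algorithm.
Variables (R : realType) (N : finType).

Definition explored (f : {set N} -> R) a (slots : seq N) (unit : R) m
    (cs : seq {set N}) :=
  exists t, [/\ table_ok f (units a unit m) slots t, size t = m.+1 &
    forall c y, (c <= m)%N -> y \in slots -> entry t c y \in cs].

(* Levels of the table shared by all slot elements: fine enough to lose only a
   fraction [O(1 / #|N|)] of the value. *)
Definition fine_levels : nat := (1024 * #|N| ^ 2)%N.

(* Levels of the table of a pair of slot elements, which divide the capacity left
   by the pair; used if the pair has a constant fraction of the value. *)
Definition coarse_levels : nat := (128 * #|N|)%N.

Section Candidate.
Variables (f : {set N} -> R).
Hypotheses (f0 : nonneg f) (fsym : symmetric_fun f) (fsub : submodular f).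
Variables (a : N -> R) (b : R).
Hypotheses (a01 : forall v, 0 <= a v <= 1) (b1 : 1 <= b).

Lemma exists_heaviest (O : {set N}) : O != set0 ->
  exists2 y, y \in O & forall v, v \in O -> a v <= a y.
Proof.
case/set0Pn => i0 i0O; case: (arg_maxP a i0O) => y yO ymax.
by exists y.
Qed.

Lemma exists_good_candidate (O : {set N}) cs : feasible a b O ->
  set0 \in cs ->
  explored f a (enum N) (b / fine_levels%:R) fine_levels cs ->
  (forall y1 y2, explored f a [:: y1; y2]
    ((b - a y1 - a y2) / coarse_levels%:R) (2 * coarse_levels) cs) ->
  exists2 A, A \in cs /\ feasible a b A & 2^-1 * (1 - expR (- 2)) * f O <= f A.
Proof.
move=> Ob cs0 [t [tok tm tcs]] coarse.
have a0 v : 0 <= a v by case/andP: (a01 v).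
have a1 v : a v <= 1 by case/andP: (a01 v).
have ratio_le V H : 0 <= V -> V <= 2 * H -> 2^-1 * (1 - expR (- 2)) * V <= H.
  move=> V0 VH; have : 0 <= expR (- 2) * V by rewrite mulr_ge0 ?expR_ge0.
  lra.
have single y : [set y] \in cs /\ feasible a b [set y].
  split; first by rewrite -(table_start tok y); apply: tcs; rewrite ?mem_enum.
  by rewrite /feasible big_set1; exact: le_trans (a1 y) b1.
have [O0|Onz] := eqVneq O set0.
  exists set0; first by split=> //; rewrite /feasible big_set0 (le_trans ler01 b1).
  by rewrite O0; apply: ratio_le => //; have := f0 set0; lra.
have [y1 O1 y1max] := exists_heaviest Onz.
have [O10|O1nz] := eqVneq (O :\ y1) set0.
  exists [set y1]; first exact: single.
  have -> : O = [set y1] by rewrite -(setD1K O1) O10 setU0.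
  by apply: ratio_le => //; have := f0 [set y1]; lra.
have [y2 O2 y2max] := exists_heaviest O1nz.
have a21 : a y2 <= a y1 by apply: y1max; case/setD1P: O2.
have aO v : v \in O :\ y1 :\ y2 -> a v <= a y2 by move=> /setD1P[_]; exact: y2max.
set n := #|N|; set V := f O.
have V0 : 0 <= V by exact: f0.
have n2 : (2 <= n)%N by rewrite (leq_trans _ (card_setD2 O1 O2))// leq_addl.
pose x : R := n%:R^-1.
have n0 : (0 < n)%N := ltnW n2.
have nR : 0 < n%:R :> R by rewrite ltr0n.
have x0 : 0 < x by rewrite invr_gt0.
have x2 : x <= 2^-1 by rewrite lef_pV2 ?posrE// ler_nat.
have m0 : (0 < fine_levels)%N by rewrite muln_gt0 expn_gt0 n0.
have mR : 0 < fine_levels%:R :> R by rewrite ltr0n.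
set unit := b / _ in tok.
have b0 : 0 < b := lt_le_trans ltr01 b1.
have unit0 : 0 < unit by rewrite divr_gt0.
have mb : fine_levels%:R * unit = b by rewrite /unit; field; exact: lt0r_neq0.
have nx : n%:R * x = 1 by rewrite /x mulfV// lt0r_neq0.
have nunit : n%:R * unit = b * x / 1024.
  rewrite /unit /x /fine_levels natrM natrX; field.
  by rewrite -/n; exact: lt0r_neq0.
have unit_le : 2 * unit <= b * x / 1024.
  by rewrite -nunit ler_pM2r// ler_nat.
have sl y : y \in enum N by rewrite mem_enum.
pose K := Num.max (f [set y1]) (f [set y2]).
have K0 : 0 <= K by rewrite le_max f0.
have V1K : V <= K + f (O :\ y1).
  apply: le_trans (le_setD1 f0 fsub O y1) _; rewrite lerD2r /K le_max lexx //.
set S := \sum_(v in O :\ y1 :\ y2) a v.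
have S0 : 0 <= S by apply: sumr_ge0.
have Sb : a y1 + a y2 + S <= b by move: Ob; rewrite /feasible (sum_rest _ O1 O2).
have := a0 y1; have := a0 y2 => a20 a10.
have fine_case kap : 0 <= kap <= 1 -> kap * V <= K ->
    (1 - kap) * (S + b * x / 1024) <= b - a y1 - a y2 - unit ->
    exists2 A, A \in cs /\ feasible a b A & 2^-1 * (1 - expR (- 2)) * f O <= f A.
  move=> /andP[k0 k1] kV; rewrite -nunit => kS.
  have rho0 : 0 <= 1 - kap by lra.
  have [c [y [cm ys Fy]]] := fine_guarantee f0 fsym fsub a01 O1 O2 a21 aO Ob unit0 mb
    tok tm (sl y1) (sl y2) rho0 kS.
  move=> bound; exists (entry t c y); first by split=> //; exact: tcs.
  exact: ratio_of_head_start V0 kV k0 (lexx _) bound.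
have bx0 : 0 < b * x by rewrite mulr_gt0.
have xb : b * x <= b / 2 by rewrite ler_pM2l.
(* If even the heaviest element is this light, the rest of [O] costs at most [b / 8] and no head
   start is needed. *)
have [ysmall|ybig] := leP (a y1) (b * x / 8).
  apply: (fine_case 0); [by rewrite lexx ler01|by rewrite mul0r|].
  have : S <= n%:R * a y1.
    apply: (@le_trans _ _ (\sum_(v in O :\ y1 :\ y2) a y1)).
      by apply: ler_sum => v /aO av; exact: le_trans av a21.
    rewrite sumr_const -[leLHS]mulr_natl ler_wpM2r// ler_nat.
    by rewrite (leq_trans _ (card_setD2 O1 O2))// leq_addr.
  have : n%:R * a y1 <= n%:R * (b * x / 8) by rewrite ler_pM2l.
  have -> : n%:R * (b * x / 8) = b / 8 by transitivity (n%:R * x * b / 8); [ring|rewrite nx mul1r].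
  lra.
pose s := a y1 / b.
have sb : a y1 = s * b by rewrite /s; field; exact: lt0r_neq0.
have s0 : 0 <= s by rewrite divr_ge0// ltW.
have s1 : s <= 1 by rewrite ler_pdivrMr// mul1r; lra.
have xs : x <= 8 * s.
  rewrite -(ler_pM2r b0) [x * b]mulrC; move: ybig; rewrite sb; lra.
have [Kbig|Ksmall] := leP (s / 32 * V) K.
  have [lbig|lsmall] := leP (b / 2) (b - a y1 - a y2).
    (* The head start [s / 32] is at least [x / 256] by [xs]. *)
    apply: (fine_case (x / 256)); first by apply/andP; split; lra.
      by apply: le_trans Kbig; rewrite ler_wpM2r//; lra.
    by apply: rest_le_fine => //; lra.
  have [t' [tok' tm' tcs']] := coarse y1 y2.
  have py2 : y2 \in [:: y1; y2] by rewrite !inE eqxx orbT.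
  have c0 : (0 < coarse_levels)%N by rewrite muln_gt0 n0.
  have rhoP : (127 / 128 : R) * (coarse_levels%:R + n%:R) <= coarse_levels%:R.
    by rewrite /coarse_levels natrM -/n; lra.
  have rho0 : 0 <= 127 / 128 :> R by lra.
  have [c [y [cm ys Fy]]] := coarse_guarantee f0 fsym fsub a01 O1 O2 a21 aO Ob c0
    tok' tm' (mem_head _ _) py2 rho0 rhoP.
  move=> bound; exists (entry t' c y); first by split=> //; exact: tcs'.
  (* The pair costs more than [b / 2], so its heavier element has [s >= 1 / 4] and the head start is
     at least [1 / 128]. *)
  apply: (@ratio_of_head_start _ _ _ _ 128^-1 _ V0 _ _ _ bound); [|lra|lra].
  have s4 : 4^-1 <= s by rewrite ler_pdivlMr//; lra.
  by apply: le_trans Kbig; rewrite ler_wpM2r//; lra.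
(* With a tiny head start, [y1] is dropped and the shared table is used for the next two heaviest
   elements. *)
have V1 : (1 - s / 32) * V <= f (O :\ y1) by lra.
have Ob1 : \sum_(v in O :\ y1) a v <= b - a y1.
  by move: Ob; rewrite /feasible (big_setD1 y1)//=; lra.
have Ob1' : feasible a b (O :\ y1) by rewrite /feasible; lra.
have [O20|O2nz] := eqVneq (O :\ y1 :\ y2) set0.
  have E : O :\ y1 = [set y2] by rewrite -(setD1K O2) O20 setU0.
  exists [set y2]; first exact: single.
  apply: ratio_le => //; move: V1; rewrite E.
  have : s * V <= V by rewrite ler_piMl.
  rewrite -/V; lra.
have [y3 O3 y3max] := exists_heaviest O2nz.
have a32 : a y3 <= a y2 by exact: aO.
have aO3 v : v \in O :\ y1 :\ y2 :\ y3 -> a v <= a y3.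
  by move=> /setD1P[_]; exact: y3max.
set S3 := \sum_(v in O :\ y1 :\ y2 :\ y3) a v.
have S30 : 0 <= S3 by apply: sumr_ge0.
have S3b : a y2 + a y3 + S3 <= b - a y1.
  by move: Ob1; rewrite (sum_rest _ O2 O3).
have := a0 y3 => a30.
have rho0 : 0 <= 1 + 3 / 4 * s by lra.
have rhoP : (1 + 3 / 4 * s) * (S3 + n%:R * unit) <= b - a y2 - a y3 - unit.
  by rewrite nunit; apply: (rest_le_speedup s0 b0 sb xs) => //; lra.
have [c [y [cm ys Fy]]] := fine_guarantee f0 fsym fsub a01 O2 O3 a32 aO3 Ob1' unit0 mb
  tok tm (sl y2) (sl y3) rho0 rhoP.
move=> bound; exists (entry t c y); first by split=> //; exact: tcs.
apply: (ratio_of_speedup (t := s) V0 _ V1 _ (lexx _) bound); first by rewrite s0.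
by rewrite le_max f0.
Qed.

End Candidate.
End Algorithm.

(** * The algorithm *)

Section Search.
Variables (R : realType) (N : finType).
Implicit Types (a : N -> R) (b unit : R) (slots : seq N).

Definition explore a slots unit m : prog R N (seq {set N}) :=
  bind (grow R (units a unit m) slots m) (fun t =>
    Ret R N [seq entry t c y | y <- slots, c <- iota 0 m.+1]).

Fixpoint explore_all a (l : seq (seq N * R * nat)) : prog R N (seq {set N}) :=
  if l is (slots, unit, m) :: l' then
    bind (explore a slots unit m) (fun cs => bind (explore_all a l') (fun cs' =>
      Ret R N (cs ++ cs')))
  else Ret R N [:: set0].

(** A pair that does not fit gives a negative unit; this is harmless, as [search] keeps only
    feasible candidates. *)
Definition tables a b : seq (seq N * R * nat) :=
  (enum N, b / (fine_levels N)%:R, fine_levels N) ::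
  [seq ([:: p.1; p.2], (b - a p.1 - a p.2) / (coarse_levels N)%:R,
        (2 * coarse_levels N)%N) | p <- enum {: N * N}].

Definition search a b : prog R N {set N} :=
  bind (explore_all a (tables a b)) (fun cs =>
    argmaxq R set0 [seq A <- cs | feasible a b A]).

Definition table_queries s m := (m * (s * (4 * #|N| + 2 * s)))%N.

Section Spec.
Variable f : {set N} -> R.
Hypotheses (f0 : nonneg f) (fsym : symmetric_fun f) (fsub : submodular f).

Lemma exploredW a slots unit m cs cs' : {subset cs <= cs'} ->
  explored f a slots unit m cs -> explored f a slots unit m cs'.
Proof.
by move=> sub [t [tok tm tcs]]; exists t; split=> // c y cm ys; apply/sub/tcs.
Qed.

Lemma exploreP a slots unit m :
  ensures f (explore a slots unit m)
    (fun cs => explored f a slots unit m cs /\ size cs = (size slots * m.+1)%N)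
    (table_queries (size slots) m).
Proof.
have w0 v : (0 < units a unit m v)%N by [].
rewrite -[table_queries _ _]addn0 /table_queries.
apply: ensures_bind (growP fsub slots w0 m f0 fsym) _ => t [tok tm].
split; last by rewrite size_allpairs size_iota.
exists t; split=> // c y cm ys; apply/allpairsP; exists (y, c).
by rewrite mem_iota.
Qed.

Lemma explore_allP a l :
  ensures f (explore_all a l)
    (fun cs => [/\ set0 \in cs,
       forall slots unit m, (slots, unit, m) \in l -> explored f a slots unit m cs &
       size cs = (1 + \sum_(x <- l) size x.1.1 * x.2.+1)%N])
    (\sum_(x <- l) table_queries (size x.1.1) x.2).
Proof.
elim: l => [|[[slots unit] m] l IH] /=.
  by rewrite !big_nil; split=> //; exact: mem_head.
rewrite [X in ensures _ _ _ X]big_cons; apply: ensures_bind (exploreP _ _ _ _) _ => cs [ecs scs].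
rewrite -[X in ensures _ _ _ X]addn0.
apply: ensures_bind IH _ => cs' [cs0 ecs' scs'] /=; split.
- by rewrite mem_cat cs0 orbT.
- move=> slots' unit' m'; rewrite inE => /orP[/eqP[-> -> ->]|le].
    by apply: exploredW ecs => A Acs; rewrite mem_cat Acs.
  by apply: exploredW (ecs' _ _ _ le) => A Acs; rewrite mem_cat Acs orbT.
- by rewrite size_cat scs scs' big_cons addnCA.
Qed.

Lemma searchP a b : (forall v, 0 <= a v <= 1) -> 1 <= b ->
  ensures f (search a b) (approx_solution (2^-1 * (1 - expR (- 2))) f a b)
    (\sum_(x <- tables a b) table_queries (size x.1.1) x.2 +
     2 * (1 + \sum_(x <- tables a b) size x.1.1 * x.2.+1)).
Proof.
move=> a01 b1; apply: ensures_bind (explore_allP _ _) _ => cs [cs0 ecs scs].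
apply: (ensures_weaken _ _ (argmaxqP _ _ _)); last first.
  by rewrite leq_mul2l /= size_filter (leq_trans (count_size _ _))// scs.
move=> C [Cin Cmax]; split.
  move: Cin; rewrite inE mem_filter => /orP[/eqP ->|/andP[//]].
  by rewrite /feasible big_set0 (le_trans ler01 b1).
move=> O Ob; have [||A [Acs Ab] ratioA] :=
    @exists_good_candidate _ _ _ f0 fsym fsub _ _ a01 b1 O cs Ob cs0.
- exact/ecs/mem_head.
- move=> y1 y2; apply: ecs; rewrite inE; apply/orP; right.
  by apply/mapP; exists (y1, y2) => //; rewrite mem_enum.
apply: (le_trans ratioA); apply: Cmax.
by rewrite inE mem_filter Ab Acs orbT.
Qed.

End Spec.

(** With [n = #|N|], the shared table takes [6144 * n ^ 4] queries, the tables of pairs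
    [2048 * (n ^ 4 + n ^ 3)], and the final comparison [O(n ^ 3)]. *)
Lemma search_queries a b : (0 < #|N|)%N ->
  (\sum_(x <- tables a b) table_queries (size x.1.1) x.2 +
    2 * (1 + \sum_(x <- tables a b) size x.1.1 * x.2.+1) <=
   16 * 1024 * #|N| ^ 4)%N.
Proof.
move=> n0; rewrite /tables !big_cons !big_map /= !big_const_seq !count_predT.
rewrite !iter_addn_0 -!enumT -!cardE card_prod /table_queries /fine_levels /coarse_levels.
move: #|N| n0 => n n0; rewrite !expnS expn0 !muln1.
have h1 : (n <= n * n)%N by rewrite leq_pmulr.
have h2 : (n * n <= n * n * n)%N by rewrite leq_pmulr.
have h3 : (n * n * n <= n * n * n * n)%N by rewrite leq_pmulr.
lia.
Qed.

End Search.

Theorem theorem5 (R : realType) :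
  exists A : knapsack_algorithm R,
    has_approx_ratio (2^-1 * (1 - expR (- 2))) A /\
    query_complexity_O (fun n => (n ^ 4)%N) A.
Proof.
exists (fun N a b => to_oracle (search a b)); split.
  move=> N f a b [f0 fsym fsub a01 b1].
  exact: (ensures_to_oracle (searchP f0 fsym fsub a01 b1)).1.
exists (16 * 1024)%N, 1%N => N f a b n0 [f0 fsym fsub a01 b1].
apply: leq_trans (ensures_to_oracle (searchP f0 fsym fsub a01 b1)).2 _.
exact: search_queries.
Qed.
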